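(* Let $r,z\ge 1$ be integers and let $G$ be an $(r,z,2;+1)$-graph, i.e. a $2$-geodetic mixed graph with minimum undirected degree $\ge r$, minimum directed out-degree $\ge z$ and order $(r+z)^2+z+2$. Then $G$ is totally regular.
   Context: A mixed graph $G$ consists of a finite set $V(G)$ of vertices, a set $E(G)$ of unordered pairs of vertices (edges, $u\sim v$) and a set $A(G)$ of ordered pairs (arcs, $u\to v$). There are no loops and no parallel edges or arcs, and $u\sim v$ and $u\to v$ cannot hold simultaneously. Mixed graphs are assumed proper: both $E(G)$ and $A(G)$ are non-empty. The undirected degree of $u$ is $d(u)=|\{v:u\sim v\}|$, the directed out-degree is $d^+(u)=|\{v:u\to v\}|$ and the directed in-degree is $d^-(u)=|\{v:v\to u\}|$. A mixed path of length $t$ is a walk $u_0u_1\dots u_t$ with $u_i\sim u_{i+1}$ or $u_i\to u_{i+1}$ for each $i$ that is non-backtracking, i.e. contains no sub-walk $u_i\sim u_{i+1}\sim u_i$ (length $0$ is allowed). $G$ is $k$-geodetic if for any ordered pair of (not necessarily distinct) vertices $u,v$ there is at most one mixed path from $u$ to $v$ of length $\le k$. The mixed Moore bound for $k=2$ is $M(r,z,2)=(r+z)^2+z+1$; an $(r,z,2;+1)$-graph has order $M(r,z,2)+1$. $G$ is out-regular if $d(u)=d(v)$ and $d^+(u)=d^+(v)$ for all vertices $u,v$; it is totally regular if it is out-regular and $d^-(u)=d^+(u)$ for every vertex $u$. *)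

(* Defs.v *)
From mathcomp Require Import all_boot.

Set Implicit Arguments.
Unset Strict Implicit.
Unset Printing Implicit Defensive.

(* Opposite arcs u -> v and v -> u are not excluded: arcs are ordered pairs. *)
Record mixed_graph (V : finType) := MixedGraph {
  edge : rel V;
  arc : rel V;
  edge_sym : symmetric edge;
  edge_irr : irreflexive edge;
  arc_irr : irreflexive arc;
  edge_arc_disj : forall u v : V, ~~ (edge u v && arc u v);
  edge_nonempty : exists u v : V, edge u v;
  arc_nonempty : exists u v : V, arc u v
}.

Section MixedGraph.

Variables (V : finType) (G : mixed_graph V).

Definition udeg (u : V) : nat := #|[set v | edge G u v]|.
Definition outdeg (u : V) : nat := #|[set v | arc G u v]|.
Definition indeg (u : V) : nat := #|[set v | arc G v u]|.

Definition mixed_step : rel V := fun u v => edge G u v || arc G u v.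

Fixpoint nonbacktracking (w : seq V) : bool :=
  if w is x :: w' then
    (if w' is y :: z :: _ then ~~ [&& edge G x y, edge G y z & z == x]
     else true) && nonbacktracking w'
  else true.

(* The walk u_0 u_1 ... u_t is given by its origin u = u_0 and the sequence
   p = [:: u_1; ...; u_t], so its length is size p.  Since edges and arcs are
   disjoint, the vertex sequence determines which steps are edges. *)
Definition mixed_path (u : V) (p : seq V) : bool :=
  path mixed_step u p && nonbacktracking (u :: p).

Definition geodetic (k : nat) : Prop :=
  forall (u v : V) (p q : seq V),
    mixed_path u p -> last u p = v -> size p <= k ->
    mixed_path u q -> last u q = v -> size q <= k ->
    p = q.

Definition out_regular : Prop :=
  forall u v : V, udeg u = udeg v /\ outdeg u = outdeg v.

Definition totally_regular : Prop :=
  out_regular /\ forall u : V, indeg u = outdeg u.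

End MixedGraph.

Definition moore_bound2 (r z : nat) : nat := (r + z) ^ 2 + z + 1.

(* (r, z, 2; +1)-graphs *)
Definition excess_one_graph (r z : nat) (V : finType) (G : mixed_graph V) :
    Prop :=
  [/\ geodetic G 2,
      forall u : V, r <= udeg G u,
      forall u : V, z <= outdeg G u
    & #|V| = moore_bound2 r z + 1].

(* Main.v *)
From mathcomp Require Import all_boot all_order all_algebra.
From mathcomp Require Import zify.
Require Import Defs.
Import Order.TTheory GRing.Theory Num.Theory.

(** Put k = r + z.  A vertex u starts
    1 + d+(u) + sum of (d + d+)(v) over the k or more steps u -> v, u ~ v
    mixed paths of length at most 2, and these have distinct ends.  One extra
    edge or arc anywhere would give more than k^2 + z + 2 of them, so
    d = r and d+ = z everywhere ([degrees]), and each vertex u then misses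
    exactly one vertex, its outlier ([sum_missed1]).

    For in-degrees, let y(v) = d-(v) - z and let p(v) be the number of vertices
    that miss v.  Counting the short paths that end at v gives ([surplus_eq])
      (k + 1) y(v) + (sum of y(a) over the steps a -> v, a ~ v) + p(v) = 1,
    and y sums to 0 over all vertices.  Let P = {y > 0} and U = {y < 0}.  Add
    these equations over P and subtract k times the sum of y: the result is a
    vanishing sum of terms [slack], one for each vertex, all of them
    nonnegative.  Hence each term is 0, which says that on P one has y = 1 and
    p = 0 and no step stays inside P ([overP]), and that every step out of U
    goes to P ([underP]).

    Suppose that U has an element w.  As p = 0 on P, w reaches every vertex of
    P, and it does so in one step because a two-step path from w leaves P.  So
    P is exactly the set of out-neighbours of every vertex of U
    ([step_under]); thus |P| = k, the deficits -y over U add up to k, and since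
    each is at most z < k, U has a second element w'.  If r >= 2, two edges
    v1 ~ w and v2 ~ w would give two paths from w' to w; hence r = 1
    ([r_eq1]).  The equation at w then reads p(w) = (k + 1)(-y(w)), so p adds up
    to (k + 1) k = |V| - 1 over U.  But two vertices of U reach each other
    through P, so the vertices of U have their outliers outside U, and the sum
    of p over U is at most |V| - |U| <= |V| - 2.  Thus U is empty, and y, which
    is nonnegative with sum 0, vanishes. *)

Set Implicit Arguments.
Unset Strict Implicit.
Unset Printing Implicit Defensive.

(** * Counting mixed paths of length at most two *)

Lemma Posz_sum (I : finType) (F : I -> nat) :
  ((\sum_i F i)%N%:Z = \sum_i (F i)%:Z)%R.
Proof. exact: (big_morph Posz PoszD). Qed.

Section ShortPaths.

Variables (V : finType) (G : mixed_graph V).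

Local Notation step := (mixed_step G).

Definition outsteps (u : V) : nat := \sum_v step u v.
Definition insteps (v : V) : nat := \sum_u step u v.

Definition two_path (u a v : V) : bool :=
  [&& step u a, step a v & ~~ [&& edge G u a, edge G a v & v == u]].

Definition short_paths (u v : V) : nat :=
  (u == v) + step u v + \sum_a two_path u a v.

(** In a 2-geodetic graph [short_paths] is 0 or 1, so [missed u v] is the
    indicator of v being out of reach from u within two steps. *)
Definition missed (u v : V) : nat := 1 - short_paths u v.

Definition missers (v : V) : nat := \sum_u missed u v.

Lemma udegE u : udeg G u = \sum_v edge G u v.
Proof.
by rewrite /udeg -sum1dep_card big_mkcond; apply: eq_bigr => v _; case: edge.
Qed.

Lemma outdegE u : outdeg G u = \sum_v arc G u v.
Proof.
by rewrite /outdeg -sum1dep_card big_mkcond; apply: eq_bigr => v _; case: (arc G _ _).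
Qed.

Lemma indegE v : indeg G v = \sum_u arc G u v.
Proof.
by rewrite /indeg -sum1dep_card big_mkcond; apply: eq_bigr => u _; case: (arc G _ _).
Qed.

Lemma stepE u v : step u v = edge G u v + arc G u v :> nat.
Proof.
by have := edge_arc_disj G u v; rewrite /mixed_step; case: edge; case: (arc G _ _).
Qed.

Lemma outstepsE u : outsteps u = udeg G u + outdeg G u.
Proof.
rewrite udegE outdegE -big_split; apply: eq_bigr => v _; exact: stepE.
Qed.

Lemma instepsE v : insteps v = udeg G v + indeg G v.
Proof.
rewrite udegE indegE -big_split; apply: eq_bigr => u _.
by rewrite stepE (edge_sym G).
Qed.

(** Among the two-step walks from u, those that backtrack are the closed ones
    along an edge at u. *)
Lemma sum_two_path u v :
  \sum_a two_path u a v + (u == v) * udeg G u = \sum_a step u a * step a v.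
Proof.
rewrite udegE big_distrr -big_split; apply: eq_bigr => a _ /=.
rewrite /two_path /mixed_step; case: (eqVneq u v) => [<-|_]; last first.
  by rewrite !andbF /= andbT addn0 mulnb.
rewrite andbT (edge_sym G a u).
by case: edge; case: arc; case: (arc G _ _).
Qed.

Lemma sum_short_paths_from u :
  \sum_v short_paths u v + udeg G u
    = 1 + outsteps u + \sum_a step u a * outsteps a.
Proof.
have one f : \sum_v (u == v) * f v = f u.
  rewrite (bigD1 u) //= eqxx mul1n big1 ?addn0 // => v.
  by rewrite eq_sym => /negbTE->.
have -> : 1 = \sum_v (u == v) * 1 by rewrite one.
rewrite -{1}(one (fun=> udeg G u)) /outsteps.
have -> : \sum_a step u a * (\sum_v step a v)
    = \sum_v \sum_a step u a * step a v.
  by rewrite exchange_big; apply: eq_bigr => a _; rewrite big_distrr.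
rewrite -!big_split; apply: eq_bigr => v _ /=.
by rewrite -sum_two_path /short_paths muln1 !addnA.
Qed.

Lemma sum_short_paths_to v :
  \sum_u short_paths u v + udeg G v
    = 1 + insteps v + \sum_a step a v * insteps a.
Proof.
have one f : \sum_u (u == v) * f u = f v.
  rewrite (bigD1 v) //= eqxx mul1n big1 ?addn0 // => u.
  by move=> /negbTE->.
have -> : 1 = \sum_u (u == v) * 1 by rewrite one.
rewrite -{1}(one (udeg G)) /insteps.
have -> : \sum_a step a v * (\sum_u step u a)
    = \sum_u \sum_a step u a * step a v.
  by rewrite exchange_big; apply: eq_bigr => a _; rewrite -big_distrl mulnC.
rewrite -!big_split; apply: eq_bigr => u _ /=.
by rewrite -sum_two_path /short_paths muln1 !addnA.
Qed.

Section Geodetic.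

Hypothesis geo : geodetic G 2.

Lemma two_pathP u a v : two_path u a v -> mixed_path G u [:: a; v].
Proof. by case/and3P=> ua av nb; rewrite /mixed_path /= ua av nb. Qed.

Lemma two_path_inj u a b v : two_path u a v -> two_path u b v -> a = b.
Proof.
by move=> /two_pathP pa /two_pathP pb; have [] := geo pa erefl isT pb erefl isT.
Qed.

Lemma two_path_neq u a v : two_path u a v -> u != v.
Proof.
move/two_pathP=> pa; apply/eqP=> uv.
by have := geo (p := [::]) (isT : mixed_path G u [::]) uv isT pa erefl isT.
Qed.

Lemma two_path_nstep u a v : two_path u a v -> ~~ step u v.
Proof.
move/two_pathP=> pa; apply/negP=> uv.
have pv : mixed_path G u [:: v] by rewrite /mixed_path /= uv.
by have := geo pv erefl isT pa erefl isT.
Qed.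

Lemma step_neq u v : step u v -> u != v.
Proof.
by apply: contraL => /eqP->; rewrite /mixed_step (edge_irr G) (arc_irr G).
Qed.

Lemma short_paths_le1 u v : short_paths u v <= 1.
Proof.
rewrite /short_paths; case: (pickP (fun a => two_path u a v)) => [a pa|nopath].
  rewrite (negbTE (two_path_neq pa)) (negbTE (two_path_nstep pa)) (bigD1 a) //=.
  rewrite pa big1 // => b; case pb: (two_path u b v) => //.
  by rewrite (two_path_inj pb pa) eqxx.
rewrite big1 => [|a _]; last by rewrite nopath.
case uv: (step u v); last by case: (u == v).
by rewrite (negbTE (step_neq uv)).
Qed.

Lemma missedK u v : short_paths u v + missed u v = 1.
Proof. exact: subnKC (short_paths_le1 u v). Qed.

Lemma sum_missed_from u : \sum_v short_paths u v + \sum_v missed u v = #|V|.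
Proof. by rewrite -big_split /= (eq_bigr _ (fun v _ => missedK u v)) sum1_card. Qed.

Lemma sum_missed_to v : \sum_u short_paths u v + missers v = #|V|.
Proof. by rewrite -big_split /= (eq_bigr _ (fun u _ => missedK u v)) sum1_card. Qed.

Lemma two_path_not_missed u a v : two_path u a v -> missed u v = 0.
Proof.
move=> pa; apply/eqP; rewrite subn_eq0 /short_paths (bigD1 a) //= pa.
by rewrite addnCA.
Qed.

End Geodetic.

End ShortPaths.

(** * Out-regularity and the in-degree equation *)

Section ExcessOne.

Variables (r z : nat) (V : finType) (G : mixed_graph V).
Hypotheses (hr : 1 <= r) (hz : 1 <= z) (hG : excess_one_graph r z G).

Local Notation step := (mixed_step G).
Local Notation k := (r + z).

Let geo : geodetic G 2. Proof. by case: hG. Qed.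

Let card_V : #|V| = k ^ 2 + z + 2.
Proof. by case: hG => _ _ _ ->; rewrite /moore_bound2 -addnA. Qed.

(** The short paths from u already number more than |V| if the total
    out-degree of u exceeds r + z. *)
Lemma degrees u : udeg G u = r /\ outdeg G u = z.
Proof.
case: hG => _ /(_ _) hd /(_ _) hd' _.
have hD a : k <= outsteps G a by rewrite outstepsE leq_add.
have := sum_short_paths_from G u; have := sum_missed_from geo u.
have : outsteps G u * k <= \sum_a step u a * outsteps G a.
  by rewrite {1}/outsteps big_distrl; apply: leq_sum => a _; rewrite leq_mul ?hD.
rewrite card_V outstepsE; have := hd u; have := hd' u; nia.
Qed.

Let udeg_r u : udeg G u = r. Proof. by case: (degrees u). Qed.

Let outsteps_k u : outsteps G u = k.
Proof. by rewrite outstepsE; case: (degrees u) => -> ->. Qed.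

Lemma sum_missed1 u : \sum_v missed G u v = 1.
Proof.
have := sum_short_paths_from G u; have := sum_missed_from geo u.
under [\sum_a step _ _ * _]eq_bigr do rewrite outsteps_k.
rewrite -big_distrl -/(outsteps G u) outsteps_k udeg_r card_V /=; nia.
Qed.

Definition surplus (v : V) : int := ((indeg G v)%:Z - z%:Z)%R.
Local Notation y := surplus.

Lemma sum_surplus : (\sum_v y v = 0)%R.
Proof.
rewrite big_split /= sumrN -!Posz_sum.
have -> : \sum_v indeg G v = \sum_v outdeg G v.
  under eq_bigr do rewrite indegE; rewrite exchange_big.
  by under eq_bigr do rewrite -outdegE.
by rewrite (eq_bigr (fun=> z)) ?subrr // => v _; case: (degrees v).
Qed.

(** The number of short paths ending at v, counted by their last step and
    written in terms of the deviations from the average in-degree. *)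
Lemma surplus_eq v :
  (k.+1%:Z * y v + \sum_a (step a v)%:Z * y a + (missers G v)%:Z = 1)%R.
Proof.
have eqX a : ((insteps G a)%:Z = k%:Z + y a)%R.
  rewrite instepsE udeg_r /surplus; lia.
have : ((\sum_a step a v * insteps G a)%N%:Z
    = (insteps G v)%:Z * k%:Z + \sum_a (step a v)%:Z * y a)%R.
  rewrite Posz_sum /insteps Posz_sum mulr_suml -big_split /=.
  by apply: eq_bigr => a _; rewrite PoszM eqX mulrDr.
have := sum_short_paths_to G v; have := sum_missed_to geo v.
rewrite udeg_r card_V => h1 h2 h3.
have := eqX v; set S := (\sum_a (step a v)%:Z * y a)%R in h3 *.
move: h3 h2 h1; lia.
Qed.


(** * Vertices of large and of small in-degree *)

Definition over : {set V} := [set v | (0 < y v)%R].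
Definition under : {set V} := [set v | (y v < 0)%R].

Definition steps_into_over (v : V) : nat := \sum_(a in over) step v a.
Local Notation c := steps_into_over.

Lemma c_le_k v : c v <= k.
Proof.
rewrite -(outsteps_k v) /outsteps /c big_mkcond /=.
by apply: leq_sum => a _; case: (a \in over).
Qed.

(** The contribution of v to the sum over [over] of the equations
    [surplus_eq], minus k times the sum of the surpluses.  A step from v into
    [over] puts y v into the equation at its end, so v enters with the
    coefficient c v. *)
Definition slack (v : V) : int :=
  (((v \in over)%:Z * (k.+1%:Z * y v + (missers G v)%:Z - 1)
    + (c v)%:Z * y v - k%:Z * y v))%R.

Lemma sum_slack : (\sum_v slack v = 0)%R.
Proof.
rewrite /slack big_split /= sumrN -mulr_sumr sum_surplus mulr0 subr0 big_split.
have -> : (\sum_v (c v)%:Z * y v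
    = \sum_v (v \in over)%:Z * \sum_a (step a v)%:Z * y a)%R.
  under [RHS]eq_bigr do rewrite mulr_sumr.
  rewrite exchange_big; apply: eq_bigr => a _ /=.
  rewrite /c big_mkcond Posz_sum mulr_suml; apply: eq_bigr => v _ /=.
  by case: (v \in over); rewrite ?mul1r ?mul0r.
rewrite -big_split big1 // => v _ /=; have := surplus_eq v.
set S := (\sum_a _)%R; nia.
Qed.

(** On [over] this is (y v - 1) + p v + c v * y v, where p v counts the
    vertices that miss v; elsewhere it is (c v - k) * y v, a product of two
    nonpositive factors. *)
Lemma slack_ge0 v : (0 <= slack v)%R.
Proof.
rewrite /slack inE; have := c_le_k v.
case: ltP => [y_gt0|y_le0] /=; nia.
Qed.

Lemma slack0 v : slack v = 0%R.
Proof.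
exact: (psumr_eq0P (fun u _ => slack_ge0 u) sum_slack).
Qed.

Lemma overP v : v \in over -> [/\ y v = 1%R, missers G v = 0 & c v = 0].
Proof.
move=> vP; have := slack0 v; rewrite /slack vP; move: vP; rewrite inE.
by move=> y_gt0 eq0; split; nia.
Qed.

Lemma underP v : v \in under -> c v = k.
Proof.
move=> vU; have := slack0 v; rewrite /slack inE; move: vU; rewrite inE => y_lt0.
have := c_le_k v; case: ltP => /=; nia.
Qed.

Lemma nstep_over u v : u \in over -> v \in over -> ~~ step u v.
Proof.
move=> uP vP; have [_ _ /eqP] := overP uP.
by rewrite sum_nat_eq0 => /forall_inP/(_ v vP); case: (step u v).
Qed.

Lemma step_under_over w v : w \in under -> step w v -> v \in over.
Proof.
move=> wU wv; apply: contraTT isT => vNP.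
have := underP wU; rewrite -(outsteps_k w) /outsteps /c big_mkcond /=.
rewrite (bigD1 v) //= (negbTE vNP) [RHS](bigD1 v) //= wv.
have : \sum_(a | a != v) (if a \in over then step w a : nat else 0)
    <= \sum_(a | a != v) step w a.
  by apply: leq_sum => a _; case: (a \in over).
lia.
Qed.

(** A vertex v of [over] is missed by nobody, so w reaches it; a two-step path
    from w passes through [over] and then leaves it, so one step must do. *)
Lemma step_under w v : w \in under -> step w v = (v \in over).
Proof.
move=> wU; apply/idP/idP => [|vP]; first exact: step_under_over.
have [yv1 pv0 _] := overP vP.
have : missed G w v = 0.
  by apply/eqP; move/eqP: pv0; rewrite sum_nat_eq0 => /forallP/(_ w).
have := missedK geo w v; rewrite /short_paths => + m0; rewrite {}m0 addn0.
rewrite big1 => [|a _].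
  have -> : (w == v) = false.
    by apply/eqP => wv; move: wU; rewrite inE wv yv1.
  by rewrite addn0; case: (step w v).
apply/eqP; rewrite eqb0; apply/negP => /and3P[/(step_under_over wU) aP av _].
by move: av; apply/negP/nstep_over.
Qed.

Lemma card_over w : w \in under -> #|over| = k.
Proof.
move=> wU; rewrite -(underP wU) /c -sum1_card; apply: eq_bigr => v vP.
by rewrite step_under // vP.
Qed.

Lemma sum_surplus_under w : w \in under -> (\sum_(u in under) - y u = k%:Z)%R.
Proof.
move=> wU; have := sum_surplus.
pose above u : int := (if u \in over then 1 else 0)%R.
pose below u : int := (if u \in under then - y u else 0)%R.
rewrite (eq_bigr (fun u => above u - below u)%R) => [|u _]; last first.
  rewrite /above /below; case: (boolP (u \in over)) => uP.
    have [y1 _ _] := overP uP; by rewrite inE y1 /= subr0.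
  by move: uP; rewrite !inE; case: ltP => //; case: ltP => //; lia.
rewrite big_split sumrN /= -!big_mkcond => /eqP; rewrite subr_eq0 => /eqP <-.
by rewrite sumr_const (card_over wU) natz.
Qed.

(** All the deficits add up to r + z, but an in-degree falls short of z by at
    most z, and r > 0. *)
Lemma two_under w : w \in under -> exists2 w', w' \in under & w' != w.
Proof.
move=> wU; case: (pickP (fun u => (u \in under) && (u != w))) => [u /andP[]|no].
  by exists u.
have := sum_surplus_under wU; rewrite (bigD1 w) //= big1 => [|u uU]; last first.
  by have := no u; rewrite uU.
rewrite /surplus; lia.
Qed.

(** An arc back from v to w would close the step from w to v to a short cycle. *)
Lemma step_into_under v w : w \in under -> v \in over -> step v w = edge G v w.
Proof.
move=> wU vP; apply/idP/idP => [vw|vw]; last by rewrite /mixed_step vw.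
apply: contraTT isT => vwN; have wv : step w v by rewrite step_under.
have /(two_path_neq geo) : two_path G v w v; last by rewrite eqxx.
by rewrite /two_path vw wv (negbTE vwN).
Qed.

(** [over] is the whole out-neighbourhood of each vertex of [under]: whatever is
    joined to [over] by an edge is within two steps of all of [under]. *)
Lemma two_path_under w v w' :
  w \in under -> w' != w -> v \in over -> edge G v w' -> two_path G w v w'.
Proof.
move=> wU ww' vP vw'.
by rewrite /two_path step_under // vP /mixed_step vw' (negbTE ww') !andbF.
Qed.

Lemma edge_under_over v w : w \in under -> edge G v w -> v \in over.
Proof.
move=> wU vw; rewrite -(step_under _ wU) /mixed_step.
by rewrite (edge_sym G) vw.
Qed.

(** Two edges at w end in [over] and both lie on a two-step path to w from
    another vertex of [under]. *)
Lemma r_eq1 w : w \in under -> r = 1.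
Proof.
move=> wU; have [w' w'U w'w] := two_under wU.
apply/eqP; rewrite eqn_leq hr andbT -(udeg_r w) leqNgt.
apply/card_gt1P => -[v1 [v2 [wv1 wv2 /eqP]]]; apply.
move: wv1 wv2; rewrite !inE !(edge_sym G w) => wv1 wv2.
have ww' : w != w' by rewrite eq_sym.
by apply: (two_path_inj geo); apply: (two_path_under w'U ww');
  rewrite ?(edge_under_over wU).
Qed.

(** The steps into w come from the end of its edge, which lies in [over] and
    has surplus 1, and otherwise from vertices of surplus 0, so [surplus_eq] at
    w has 1 in the middle. *)
Lemma missers_under w : w \in under -> ((missers G w)%:Z = k.+1%:Z * - y w)%R.
Proof.
move=> wU; have := surplus_eq w.
have -> : (\sum_a (step a w)%:Z * y a = (udeg G w)%:Z)%R; last first.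
  by rewrite udeg_r [in Posz r](r_eq1 wU); lia.
rewrite udegE Posz_sum; apply: eq_bigr => a _; rewrite (edge_sym G w a).
case aw: (edge G a w).
  have [-> _ _] := overP (edge_under_over wU aw).
  by rewrite /mixed_step aw.
case saw: (step a w); rewrite ?mul0r // mul1r.
have : a \notin over by apply: contraFN aw => aP; rewrite -step_into_under.
have : a \notin under.
  apply: contraL saw => aU; rewrite step_under //.
  by move: wU; rewrite !inE; lia.
rewrite !inE; lia.
Qed.

Lemma missed_under w w' : w \in under -> w' \in under -> missed G w w' = 0.
Proof.
move=> wU w'U; case: (eqVneq w' w) => [->|w'w].
  by rewrite /missed /short_paths eqxx.
have : 0 < udeg G w' by rewrite udeg_r.
case/card_gt0P=> v; rewrite inE (edge_sym G) => vw'.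
apply: (two_path_not_missed (a := v)).
exact: two_path_under (edge_under_over w'U vw') vw'.
Qed.

Lemma sum_missers_under w : w \in under ->
  \sum_(u in under) missers G u = k.+1 * k.
Proof.
move=> wU; apply/eqP; rewrite -eqz_nat PoszM -(sum_surplus_under wU) mulr_sumr.
rewrite (big_morph Posz PoszD (erefl _)); apply/eqP.
by apply: eq_bigr => u uU; rewrite missers_under.
Qed.

(** Each vertex misses one vertex only, and the vertices of [under] miss none
    in [under]. *)
Lemma sum_missers_under_le : \sum_(u in under) missers G u + #|under| <= #|V|.
Proof.
rewrite exchange_big /= -!sum1_card [\sum_(_ in under) 1]big_mkcond -big_split.
apply: leq_sum => u _ /=; case: (boolP (u \in under)) => uU.
  by rewrite big1 // => w wU; apply: missed_under.
rewrite addn0 -(sum_missed1 u) [leqLHS]big_mkcond; apply: leq_sum => w _.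
by case: ifP.
Qed.

(** With r = 1, |V| is (k + 1) * k + 1, while the two preceding counts give
    (k + 1) * k + 2 <= |V|. *)
Lemma under_empty w : w \notin under.
Proof.
apply/negP => wU; have [w' w'U w'w] := two_under wU.
have := sum_missers_under_le; rewrite (sum_missers_under wU) card_V (r_eq1 wU).
have : 1 < #|under| by apply/card_gt1P; exists w', w.
nia.
Qed.

Lemma surplus0 v : y v = 0%R.
Proof.
apply: (psumr_eq0P _ sum_surplus) => // u _.
by have := under_empty u; rewrite inE -leNgt.
Qed.

End ExcessOne.

Theorem theorem4p3 (r z : nat) (V : finType) (G : mixed_graph V)
    (hr : 1 <= r) (hz : 1 <= z) (hG : excess_one_graph r z G) :
  totally_regular G.
Proof.
have deg := degrees hr hz hG; split=> [u v|u].
  by have [-> ->] := deg u; have [-> ->] := deg v.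
have := surplus0 hr hz hG u; rewrite /surplus; have [_ ->] := deg u; lia.
Qed.
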